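(* The log-harmonic mapping $$LS(z)=\frac{z}{1-z^2}\,|1-z^2|\exp\left(\operatorname{Re}\left(\frac{2z^2}{1-z^2}\right)\right),\qquad z\in\mathbb{D},$$ is univalent and starlike in $\mathbb{D}$, and $$LS(\mathbb{D})=\mathbb{C}\setminus\{u+iv:\ u=0,\ |v|\ge 1/e\}.$$
   Context: $\mathbb{D}$ is the open unit disk in $\mathbb{C}$; univalent means injective. A log-harmonic mapping on $\mathbb{D}$ is a solution $f$ of $\overline{f_{\overline{z}}}=\mu\,(\overline{f}/f)\,f_z$ for some analytic $\mu$ on $\mathbb{D}$ with $|\mu|<1$; here $\mu(z)=z^2$. A univalent $f\in C^1(\mathbb{D})$ with $f(0)=0$ is called starlike if $$\operatorname{Re}\left(\frac{zf_z(z)-\overline{z}f_{\overline{z}}(z)}{f(z)}\right)>0\quad\text{for all } z\in\mathbb{D}\setminus\{0\}.$$ *)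

(* Defs.v *)
From Stdlib Require Export Reals.
From Coquelicot Require Export Coquelicot.

Open Scope R_scope.

Definition unit_disk (z : C) : Prop := Cmod z < 1.

Definition univalent (f : C -> C) : Prop :=
  forall z w : C, unit_disk z -> unit_disk w -> f z = f w -> z = w.

(* Coquelicot's [Derive] is for functions R -> R, hence the components. *)
Definition partial_x (f : C -> C) (z : C) : C :=
  (Derive (fun x : R => Re (f (x, Im z))) (Re z),
   Derive (fun x : R => Im (f (x, Im z))) (Re z)).

Definition partial_y (f : C -> C) (z : C) : C :=
  (Derive (fun y : R => Re (f (Re z, y))) (Im z),
   Derive (fun y : R => Im (f (Re z, y))) (Im z)).

Definition has_partials (f : C -> C) (z : C) : Prop :=
  ex_derive (fun x : R => Re (f (x, Im z))) (Re z) /\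
  ex_derive (fun x : R => Im (f (x, Im z))) (Re z) /\
  ex_derive (fun y : R => Re (f (Re z, y))) (Im z) /\
  ex_derive (fun y : R => Im (f (Re z, y))) (Im z).

(* [continuous] refers to full neighbourhoods; as the disk is open, this is
   continuity on the disk. *)
Definition C1_on_disk (f : C -> C) : Prop :=
  forall z : C, unit_disk z ->
    has_partials f z /\
    continuous (partial_x f) z /\
    continuous (partial_y f) z.

(* Wirtinger derivatives f_z and f_{\bar z}. *)
Definition d_z (f : C -> C) (z : C) : C :=
  ((partial_x f z - Ci * partial_y f z) / 2)%C.

Definition d_zbar (f : C -> C) (z : C) : C :=
  ((partial_x f z + Ci * partial_y f z) / 2)%C.

(* Complex differentiability, the scalar field being C. *)
Definition analytic_on_disk (mu : C -> C) : Prop :=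
  forall z : C, unit_disk z ->
    ex_derive (K := C_AbsRing) (V := C_NormedModule) mu z.

(* At a zero of [f] the quotient is 0 by the convention [/ 0 = 0] in C, so the
   equation there says that f_{\bar z} vanishes.  When mu(z) = z^2 and the only
   zero is the origin, the value of the quotient is immaterial, since mu(0) = 0. *)
Definition log_harmonic (mu f : C -> C) : Prop :=
  analytic_on_disk mu /\
  (forall z : C, unit_disk z -> Cmod (mu z) < 1) /\
  C1_on_disk f /\
  (forall z : C, unit_disk z ->
     Cconj (d_zbar f z) = (mu z * (Cconj (f z) / f z) * d_z f z)%C).

Definition starlike (f : C -> C) : Prop :=
  univalent f /\
  C1_on_disk f /\
  f 0%C = 0%C /\
  (forall z : C, unit_disk z -> z <> 0%C ->
     0 < Re ((z * d_z f z - Cconj z * d_zbar f z) / f z)%C).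

Definition LS (z : C) : C :=
  (z / (1 - z ^ 2) * Cmod (1 - z ^ 2)
     * exp (Re (2 * z ^ 2 / (1 - z ^ 2))))%C.

(* Main.v *)
Require Import Defs.
From Stdlib Require Import Lra.

(** Everything is governed by the odd Koebe function [koebe z = z / (1 - z^2)] and by
    [p = (1 + z^2) / (1 - z^2)], which has positive real part and satisfies
    [p^2 = 1 + 4 (koebe z)^2]. Since [1 - z^2 = 2 / (p + 1)] and
    [2 z^2 / (1 - z^2) = p - 1],
    [LS z = koebe z * 2 / |p + 1| * exp (Re p - 1)],
    a positive multiple of [koebe z] ([LS_polar]).

    Univalence and the image are therefore questions about one ray at a time. Write
    [koebe z = t u] with [|u| = 1], and put [s = 4 t^2], [k = Re (u^2)]. Then
    [p] is the square root of [1 + s u^2] in the right half-plane, and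
    [(e |LS z|)^2 = s exp (2 Re p) / |p + 1|^2] depends only on [k] and [s]
    ([ray_gain]). Its derivative with respect to [log s] is [Re p] times itself, so it is
    strictly increasing ([ray_gain_derive], [ray_gain_lt]); as [koebe] is injective
    ([koebe_inj]), so is [LS]. Along a ray with [u^2 <> -1] the parameter [s] runs through
    all positive numbers and the gain is unbounded, so the whole ray is attained. For
    [u^2 = -1], the imaginary axis, positivity of [Re p] restricts [s] to [s < 1], and the
    gain at [s = 1] is [1], so that [LS] attains exactly the moduli below [1 / e]
    ([ray_gain_surj], [ray_gain_slit], [LS_range]).

    Differentiability is checked in real coordinates. The logarithmic Wirtinger
    derivatives of [LS] are
    [f_z / f = (1 + z^2) / (z (1 - z^2)^2)] and
    [conj (f_zbar / f) = z (1 + z^2) / (1 - z^2)^2]. Their quotient is the dilatation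
    [z^2] ([LS_log_harmonic_eq]), and the real part in the definition of starlikeness is
    [Re p] ([LS_starlike_re]). *)

(** * Partial derivatives in real coordinates *)

(** In [z = x + iy], the value of [|1 - z^2|^2], and below it the positive factor
    [|1 - z^2| exp (Re (2 z^2 / (1 - z^2)))] of [LS z]. *)
Definition den (x y : R) : R := (1 - x ^ 2 + y ^ 2) ^ 2 + (2 * x * y) ^ 2.
Definition gain (x y : R) : R :=
  sqrt (den x y) * exp (2 * (1 - x ^ 2 + y ^ 2) / den x y - 2).

Lemma den_pos (x y : R) : x ^ 2 + y ^ 2 < 1 -> 0 < den x y.
Proof. intros H. unfold den. assert (0 < 1 - x^2 + y^2) by nra. nra. Qed.

Lemma disk_coords (z : C) : unit_disk z <-> fst z ^ 2 + snd z ^ 2 < 1.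
Proof.
unfold unit_disk, Cmod. split; intros H.
- rewrite <- sqrt_1 in H. apply sqrt_lt_0_alt in H. exact H.
- rewrite <- sqrt_1. apply sqrt_lt_1_alt. split; [nra | exact H].
Qed.

(** [z / (1 - z^2) = z conj(1 - z^2) / |1 - z^2|^2], and
    [z conj(1 - z^2) = z - |z|^2 conj z]. *)
Lemma LS_coords (x y : R) : x ^ 2 + y ^ 2 < 1 ->
  LS (x, y) = (x * (1 - x ^ 2 - y ^ 2) / den x y * gain x y,
               y * (1 + x ^ 2 + y ^ 2) / den x y * gain x y).
Proof.
intros H. pose proof (den_pos x y H) as Hd.
assert (Hm : Cmod (1 - (x, y) ^ 2) = sqrt (den x y)).
{ unfold Cmod. f_equal. unfold den. cbn. ring. }
assert (He : Re (2 * (x, y) ^ 2 / (1 - (x, y) ^ 2)) =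
  2 * (1 - x ^ 2 + y ^ 2) / den x y - 2).
{ unfold den in *. cbn. field. nra. }
unfold LS. rewrite Hm, He. fold (gain x y). unfold gain.
set (E := exp _). set (S := sqrt _). unfold den in *.
apply injective_projections; cbn; field; nra.
Qed.

Lemma is_derive_sqrt_mul_exp (q N : R -> R) (t dq dN : R) :
  0 < N t -> is_derive q t dq -> is_derive N t dN ->
  is_derive (fun u => sqrt (N u) * exp (2 * q u / N u - 2)) t
    (sqrt (N t) * exp (2 * q t / N t - 2)
     * (dN / (2 * N t) + 2 * dq / N t - 2 * q t * dN / N t ^ 2)).
Proof.
intros H Hq HN.
assert (HS0 := sqrt_lt_R0 _ H).
assert (HS : sqrt (N t) * sqrt (N t) = N t) by (apply sqrt_sqrt; lra).
auto_derive.
- repeat split; trivial; try (eexists; eassumption); lra.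
- replace (Derive (fun x => q x) t) with dq by (symmetry; now apply is_derive_unique).
  replace (Derive (fun x => N x) t) with dN by (symmetry; now apply is_derive_unique).
  unfold Rminus, Rdiv. set (E := exp _). set (S := sqrt (N t)) in *.
  rewrite <- HS. field. lra.
Qed.

Lemma gain_derive_x (x y : R) : 0 < den x y ->
  let q := 1 - x ^ 2 + y ^ 2 in
  let dN := 8 * x * y ^ 2 - 4 * x * q in
  is_derive (fun t => gain t y) x
    (gain x y * (dN / (2 * den x y) + 2 * (- 2 * x) / den x y
      - 2 * q * dN / den x y ^ 2)).
Proof.
intros H q dN.
apply (is_derive_sqrt_mul_exp (fun t => 1 - t ^ 2 + y ^ 2) (fun t => den t y)); trivial.
- auto_derive; trivial. ring.
- unfold den. auto_derive; trivial. unfold dN, q. ring.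
Qed.

Lemma gain_derive_y (x y : R) : 0 < den x y ->
  let q := 1 - x ^ 2 + y ^ 2 in
  let dN := 8 * x ^ 2 * y + 4 * y * q in
  is_derive (fun t => gain x t) y
    (gain x y * (dN / (2 * den x y) + 2 * (2 * y) / den x y
      - 2 * q * dN / den x y ^ 2)).
Proof.
intros H q dN.
apply (is_derive_sqrt_mul_exp (fun t => 1 - x ^ 2 + t ^ 2) (fun t => den x t)); trivial.
- auto_derive; trivial. ring.
- unfold den. auto_derive; trivial. unfold dN, q. ring.
Qed.

(** The cube makes both Wirtinger derivatives below polynomial in [z] and
    [conj z] up to this one real factor. *)
Definition weight (z : C) : R := gain (Re z) (Im z) / den (Re z) (Im z) ^ 3.

(** With [M = |1 - z^2| exp (Re (2 z^2 / (1 - z^2)))], logarithmic differentiation of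
    [LS] gives [M (1 + z^2) / (1 - z^2)^3] for the derivative in [z], and
    [M z / (1 - z^2)] times the conjugate of [z (1 + z^2) / (1 - z^2)^2] for the one in
    [conj z]; multiplying out [1 / (1 - z^2) = conj(1 - z^2) / |1 - z^2|^2] leads to
    these two formulas. *)
Definition LS_z (z : C) : C :=
  (weight z * ((1 + z ^ 2) * Cconj (1 - z ^ 2) ^ 3))%C.

Definition LS_zbar (z : C) : C :=
  (weight z * (z * Cconj (z * (1 + z ^ 2)) * Cconj (1 - z ^ 2) * (1 - z ^ 2) ^ 2))%C.

(** The partial derivatives are recovered from the Wirtinger ones as [f_z + f_zbar] and
    [i (f_z - f_zbar)]. *)
Lemma LS_partials (x y : R) : x ^ 2 + y ^ 2 < 1 ->
  let fx := (LS_z (x, y) + LS_zbar (x, y))%C in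
  let fy := (Ci * (LS_z (x, y) - LS_zbar (x, y)))%C in
  (is_derive (fun t => t * (1 - t ^ 2 - y ^ 2) / den t y * gain t y) x (Re fx) /\
   is_derive (fun t => y * (1 + t ^ 2 + y ^ 2) / den t y * gain t y) x (Im fx)) /\
  (is_derive (fun t => x * (1 - x ^ 2 - t ^ 2) / den x t * gain x t) y (Re fy) /\
   is_derive (fun t => t * (1 + x ^ 2 + t ^ 2) / den x t * gain x t) y (Im fy)).
Proof.
intros H fx fy. pose proof (den_pos x y H) as Hd.
pose proof (gain_derive_x x y Hd) as Hx.
pose proof (gain_derive_y x y Hd) as Hy.
(* The second factor is always [gain], whose derivative is known. *)
assert (mulD : forall (f g : R -> R) t df dg l, is_derive g t dg ->
  is_derive f t df -> df * g t + f t * dg = l ->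
  is_derive (fun u => f u * g u) t l).
{ intros f g t df dg l Hg Hf <-.
  apply (is_derive_mult f g t df dg); trivial. intros; apply Rmult_comm. }
split; split.
1,2: eapply mulD; [exact Hx | unfold den; auto_derive; [nra | reflexivity] | ].
3,4: eapply mulD; [exact Hy | unfold den; auto_derive; [nra | reflexivity] | ].
all: unfold fx, fy, LS_z, LS_zbar, weight; cbn -[den gain pow]; set (M := gain x y); unfold den.
all: unfold den in Hd.
all: field; nra.
Qed.

Lemma disk_open_x (x y : R) : x ^ 2 + y ^ 2 < 1 -> locally x (fun t => t ^ 2 + y ^ 2 < 1).
Proof.
intros H. apply (open_comp (fun t => t ^ 2 + y ^ 2) (fun u => u < 1)); [ | apply open_lt | exact H].
intros t _. apply (ex_derive_continuous (fun t => t ^ 2 + y ^ 2)). auto_derive; trivial.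
Qed.

Lemma disk_open_y (x y : R) : x ^ 2 + y ^ 2 < 1 -> locally y (fun t => x ^ 2 + t ^ 2 < 1).
Proof.
intros H. apply (open_comp (fun t => x ^ 2 + t ^ 2) (fun u => u < 1)); [ | apply open_lt | exact H].
intros t _. apply (ex_derive_continuous (fun t => x ^ 2 + t ^ 2)). auto_derive; trivial.
Qed.

Lemma LS_is_derive (x y : R) : x ^ 2 + y ^ 2 < 1 ->
  let fx := (LS_z (x, y) + LS_zbar (x, y))%C in
  let fy := (Ci * (LS_z (x, y) - LS_zbar (x, y)))%C in
  (is_derive (fun t => Re (LS (t, y))) x (Re fx) /\
   is_derive (fun t => Im (LS (t, y))) x (Im fx)) /\
  (is_derive (fun t => Re (LS (x, t))) y (Re fy) /\
   is_derive (fun t => Im (LS (x, t))) y (Im fy)).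
Proof.
intros H fx fy. destruct (LS_partials x y H) as [[H1 H2] [H3 H4]].
pose proof (disk_open_x x y H) as Dx. pose proof (disk_open_y x y H) as Dy.
split; split; (eapply is_derive_ext_loc; [ | eassumption]).
1,2: revert Dx; apply filter_imp.
3,4: revert Dy; apply filter_imp.
all: intros t Ht; symmetry.
1,3: exact (f_equal Re (LS_coords _ _ Ht)).
all: exact (f_equal Im (LS_coords _ _ Ht)).
Qed.

Lemma LS_partial_x (z : C) : unit_disk z -> partial_x LS z = (LS_z z + LS_zbar z)%C.
Proof.
intros H. apply disk_coords in H. destruct z as [x y]. cbn [fst snd] in H.
destruct (LS_is_derive x y H) as [[H1 H2] _].
apply injective_projections; apply is_derive_unique; assumption.
Qed.

Lemma LS_partial_y (z : C) : unit_disk z -> partial_y LS z = (Ci * (LS_z z - LS_zbar z))%C.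
Proof.
intros H. apply disk_coords in H. destruct z as [x y]. cbn [fst snd] in H.
destruct (LS_is_derive x y H) as [_ [H1 H2]].
apply injective_projections; apply is_derive_unique; assumption.
Qed.

(** * Continuity of the partial derivatives *)

Lemma continuous_pair (f g : C -> R) (z : C) :
  continuous f z -> continuous g z -> continuous (fun w => (f w, g w) : C) z.
Proof.
intros Hf Hg.
apply (continuous_comp_2 f g (fun a b => (a, b) : C)); trivial.
apply (continuous_ext (fun p : R * R => p)); [now intros [a b] | apply continuous_id].
Qed.

Lemma continuous_Re (z : C) : continuous Re z.
Proof. destruct z; apply (continuous_fst (U := R_UniformSpace) (V := R_UniformSpace)). Qed.
Lemma continuous_Im (z : C) : continuous Im z.
Proof. destruct z; apply (continuous_snd (U := R_UniformSpace) (V := R_UniformSpace)). Qed.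

Lemma continuous_Cmult (f g : C -> C) (z : C) :
  continuous f z -> continuous g z -> continuous (fun w => (f w * g w)%C) z.
Proof.
assert (A : forall h : C -> C, continuous h z ->
  continuous (fun w => Re (h w)) z /\ continuous (fun w => Im (h w)) z).
{ intros h Hh. split; apply (continuous_comp h); trivial;
  [apply continuous_Re | apply continuous_Im]. }
intros Hf Hg. destruct (A _ Hf) as [? ?], (A _ Hg) as [? ?]. apply continuous_pair.
- apply (continuous_minus (V := R_NormedModule));
  apply (continuous_mult (K := R_AbsRing)); assumption.
- apply (continuous_plus (V := R_NormedModule));
  apply (continuous_mult (K := R_AbsRing)); assumption.
Qed.

Lemma continuous_Cconj (f : C -> C) (z : C) :
  continuous f z -> continuous (fun w => Cconj (f w)) z.
Proof.
intros Hf. apply continuous_pair.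
- apply (continuous_comp f); trivial; apply continuous_Re.
- apply (continuous_opp (V := R_NormedModule)).
  apply (continuous_comp f); trivial; apply continuous_Im.
Qed.

Lemma continuous_Cplus (f g : C -> C) (z : C) :
  continuous f z -> continuous g z -> continuous (fun w => (f w + g w)%C) z.
Proof. apply (continuous_plus (V := C_NormedModule)). Qed.

Lemma continuous_Cminus (f g : C -> C) (z : C) :
  continuous f z -> continuous g z -> continuous (fun w => (f w - g w)%C) z.
Proof. apply (continuous_minus (V := C_NormedModule)). Qed.

Lemma continuous_Cpow (f : C -> C) (n : nat) (z : C) :
  continuous f z -> continuous (fun w => (f w ^ n)%C) z.
Proof.
intros Hf. induction n as [ | n IH]; [apply continuous_const | ].
now apply continuous_Cmult.
Qed.

Lemma continuous_weight (z : C) : unit_disk z ->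
  continuous (fun w => weight w : C) z.
Proof.
intros H. apply disk_coords in H. pose proof (den_pos _ _ H) as Hd.
assert (X := continuous_Re z). assert (Y := continuous_Im z).
assert (Cm : forall f g : C -> R, continuous f z -> continuous g z ->
  continuous (fun w => f w * g w) z) by (intros; now apply (continuous_mult (K := R_AbsRing))).
assert (Ca : forall f g : C -> R, continuous f z -> continuous g z ->
  continuous (fun w => f w + g w) z) by (intros; now apply (continuous_plus (V := R_NormedModule))).
assert (Cs : forall f g : C -> R, continuous f z -> continuous g z ->
  continuous (fun w => f w - g w) z) by (intros; now apply (continuous_minus (V := R_NormedModule))).
assert (K : forall a : R, continuous (fun _ : C => a) z) by (intros; apply continuous_const).
assert (P : forall f : C -> R, continuous f z -> continuous (fun w => f w ^ 2) z).
{ intros f Hf. exact (Cm _ _ Hf (Cm _ _ Hf (K 1))). }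
assert (Q : continuous (fun w : C => 1 - Re w ^ 2 + Im w ^ 2) z).
{ exact (Ca _ _ (Cs _ _ (K 1) (P _ X)) (P _ Y)). }
assert (D : continuous (fun w : C => den (Re w) (Im w)) z).
{ exact (Ca _ _ (P _ Q) (P _ (Cm _ _ (Cm _ _ (K 2) X) Y))). }
assert (I : continuous (fun w : C => / den (Re w) (Im w)) z).
{ apply (continuous_comp _ Rinv); [exact D | ].
  apply continuous_Rinv, Rgt_not_eq, Hd. }
assert (G : continuous (fun w : C => gain (Re w) (Im w)) z).
{ apply Cm; [exact (continuous_comp _ sqrt _ D (continuous_sqrt _)) | ].
  apply (continuous_comp _ exp); [ | apply continuous_exp].
  exact (Cs _ _ (Cm _ _ (Cm _ _ (K 2) Q) I) (K 2)). }
apply continuous_pair; [ | exact (K 0)].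
apply (continuous_ext (fun w => gain (Re w) (Im w) *
  (/ den (Re w) (Im w) * (/ den (Re w) (Im w) * / den (Re w) (Im w))))).
{ intros w. unfold weight, Rdiv. cbn [pow]. now rewrite Rmult_1_r, !Rinv_mult. }
exact (Cm _ _ G (Cm _ _ I (Cm _ _ I I))).
Qed.

Lemma continuous_LS_z (z : C) : unit_disk z -> continuous LS_z z.
Proof.
intros H. assert (I := continuous_id z).
assert (W : continuous (fun w => (1 - w ^ 2)%C) z).
{ apply continuous_Cminus; [apply continuous_const | now apply continuous_Cpow]. }
apply continuous_Cmult; [now apply continuous_weight | ].
apply continuous_Cmult.
- apply continuous_Cplus; [apply continuous_const | now apply continuous_Cpow].
- now apply continuous_Cpow, continuous_Cconj.
Qed.

Lemma continuous_LS_zbar (z : C) : unit_disk z -> continuous LS_zbar z.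
Proof.
intros H. assert (I := continuous_id z).
assert (W : continuous (fun w => (1 - w ^ 2)%C) z).
{ apply continuous_Cminus; [apply continuous_const | now apply continuous_Cpow]. }
apply continuous_Cmult; [now apply continuous_weight | ].
apply continuous_Cmult; [apply continuous_Cmult; [apply continuous_Cmult | ] | ].
- exact I.
- apply continuous_Cconj, continuous_Cmult; [exact I | ].
  apply continuous_Cplus; [apply continuous_const | now apply continuous_Cpow].
- now apply continuous_Cconj.
- now apply continuous_Cpow.
Qed.

(** Needed to replace the partial derivatives by their formulas near a point before
    asking for continuity. *)
Lemma unit_disk_open (z : C) : unit_disk z -> locally z unit_disk.
Proof.
intros H. apply (open_comp Cmod (fun r => r < 1)); [ | apply open_lt | exact H].
intros w _. exact (filterlim_norm (V := C_NormedModule) w).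
Qed.

Lemma LS_C1 : C1_on_disk LS.
Proof.
intros z H. repeat apply conj.
1-4: assert (H' := H); apply disk_coords in H'; destruct z as [x y];
  destruct (LS_is_derive x y H') as [[? ?] [? ?]]; eexists; eassumption.
- apply (continuous_ext_loc _ (fun w => (LS_z w + LS_zbar w)%C)).
  + generalize (unit_disk_open z H). apply filter_imp.
    intros w Hw. symmetry. now apply LS_partial_x.
  + apply continuous_Cplus; [now apply continuous_LS_z | now apply continuous_LS_zbar].
- apply (continuous_ext_loc _ (fun w => (Ci * (LS_z w - LS_zbar w))%C)).
  + generalize (unit_disk_open z H). apply filter_imp.
    intros w Hw. symmetry. now apply LS_partial_y.
  + apply continuous_Cmult; [apply continuous_const | ].
    apply continuous_Cminus; [now apply continuous_LS_z | now apply continuous_LS_zbar].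
Qed.

Lemma d_z_LS (z : C) : unit_disk z -> d_z LS z = LS_z z.
Proof.
intros H. unfold d_z. rewrite LS_partial_x, LS_partial_y; trivial.
assert (E : (Ci * Ci = - 1)%C) by (apply injective_projections; cbn; ring).
transitivity ((LS_z z + LS_zbar z - (Ci * Ci) * (LS_z z - LS_zbar z)) / 2)%C; [ | rewrite E].
all: field; intros F; apply (f_equal fst) in F; cbn in F; lra.
Qed.

Lemma d_zbar_LS (z : C) : unit_disk z -> d_zbar LS z = LS_zbar z.
Proof.
intros H. unfold d_zbar. rewrite LS_partial_x, LS_partial_y; trivial.
assert (E : (Ci * Ci = - 1)%C) by (apply injective_projections; cbn; ring).
transitivity ((LS_z z + LS_zbar z + (Ci * Ci) * (LS_z z - LS_zbar z)) / 2)%C; [ | rewrite E].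
all: field; intros F; apply (f_equal fst) in F; cbn in F; lra.
Qed.

(** * The log-harmonic equation and starlikeness *)

Lemma analytic_square : analytic_on_disk (fun z => (z ^ 2)%C).
Proof.
assert (E : forall y z : C, (y ^ 2 - z ^ 2 - (y - z) * (2 * z) = (y - z) * (y - z))%C)
  by (intros; ring).
intros z _. exists (2 * z)%C. split; [apply is_linear_scal_l | ].
intros w Hw eps.
rewrite <- (is_filter_lim_locally_unique _ _ Hw).
exists eps. intros y Hy.
change (Cmod (y - z)%C < eps) in Hy.
change (Cmod (y ^ 2 - z ^ 2 - (y - z) * (2 * z))%C <= eps * Cmod (y - z)%C).
rewrite E, Cmod_mult. apply Rmult_le_compat_r; [apply Cmod_ge_0 | lra].
Qed.

Lemma den_conj (z : C) :
  RtoC (den (Re z) (Im z)) = ((1 - z ^ 2) * Cconj (1 - z ^ 2))%C.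
Proof. unfold den, Re, Im. apply injective_projections; cbn; ring. Qed.

Lemma one_sub_sqr_neq0 (z : C) : unit_disk z -> (1 - z ^ 2)%C <> 0.
Proof.
intros H E. apply disk_coords in H. pose proof (den_pos _ _ H) as Hd.
pose proof (den_conj z) as F. rewrite E, Cmult_0_l in F.
apply RtoC_inj in F. unfold Re, Im in F. lra.
Qed.

Lemma Cconj_RtoC (r : R) : Cconj r = r.
Proof. apply injective_projections; cbn; ring. Qed.

Lemma conj_one_sub_sqr_neq0 (z : C) : unit_disk z -> Cconj (1 - z ^ 2)%C <> 0.
Proof.
intros H E. apply (one_sub_sqr_neq0 z H).
rewrite <- (Cconj_conj (1 - z ^ 2)%C), E. apply Cconj_RtoC.
Qed.

Lemma weight_pos (z : C) : unit_disk z -> 0 < weight z.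
Proof.
intros H. apply disk_coords in H. pose proof (den_pos _ _ H) as Hd.
apply Rdiv_lt_0_compat; [ | now apply pow_lt].
apply Rmult_lt_0_compat; [now apply sqrt_lt_R0 | apply exp_pos].
Qed.

Lemma weight_neq0 (z : C) : unit_disk z -> RtoC (weight z) <> 0.
Proof. intros H E. apply RtoC_inj in E. pose proof (weight_pos z H). lra. Qed.

Lemma LS_weight (z : C) : unit_disk z ->
  LS z = (weight z * (z * (1 - z ^ 2) ^ 2 * Cconj (1 - z ^ 2) ^ 3))%C.
Proof.
intros H. apply disk_coords in H. pose proof (den_pos _ _ H) as Hd.
transitivity (weight z * ((1 - z ^ 2) * Cconj (1 - z ^ 2)) ^ 2
  * (z * Cconj (1 - z ^ 2)))%C; [ | ring].
rewrite <- den_conj. unfold weight.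
destruct z as [x y]. rewrite (LS_coords x y H). cbn [Re Im fst snd] in *.
apply injective_projections; cbn; field; lra.
Qed.

(** Away from the origin both sides are explicit monomials in [weight z], [z],
    [1 + z^2], [1 - z^2] and their conjugates; at the origin both vanish. *)
Lemma LS_log_harmonic_eq (z : C) : unit_disk z ->
  Cconj (d_zbar LS z) = (z ^ 2 * (Cconj (LS z) / LS z) * d_z LS z)%C.
Proof.
intros H. rewrite d_z_LS, d_zbar_LS, (LS_weight z) by trivial.
unfold LS_z, LS_zbar.
pose proof (weight_neq0 z H) as Hw.
pose proof (one_sub_sqr_neq0 z H) as H1.
pose proof (conj_one_sub_sqr_neq0 z H) as H2.
rewrite !Cmult_conj, !Cpow_conj, ?Cmult_conj, !Cconj_conj, Cconj_RtoC.
destruct (Ceq_dec z 0) as [-> | Hz]; [ring | ].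
field. auto.
Qed.

(** The image of [z^2] under the Cayley transform of the disk onto the right
    half-plane. *)
Definition cayley (z : C) : C := ((1 + z ^ 2) / (1 - z ^ 2))%C.

Lemma cayley_pos (z : C) : unit_disk z -> 0 < Re (cayley z).
Proof.
intros H. apply disk_coords in H.
pose proof (den_pos _ _ H) as Hd.
replace (Re (cayley z)) with
  ((1 - (fst z ^ 2 + snd z ^ 2)) * (1 + (fst z ^ 2 + snd z ^ 2)) / den (fst z) (snd z)).
- apply Rdiv_lt_0_compat; nra.
- unfold den in *. cbn. field. nra.
Qed.

(** With [a = (1 + z^2) / (1 - z^2)^2] the quotient is [a - conj (z^2 a)], which has the
    real part of [(1 - z^2) a = cayley z]. *)
Lemma LS_starlike_re (z : C) : unit_disk z -> z <> 0 ->
  0 < Re ((z * d_z LS z - Cconj z * d_zbar LS z) / LS z)%C.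
Proof.
intros H Hz. rewrite d_z_LS, d_zbar_LS, (LS_weight z) by trivial.
unfold LS_z, LS_zbar.
pose proof (weight_neq0 z H) as Hw.
pose proof (one_sub_sqr_neq0 z H) as H1.
pose proof (conj_one_sub_sqr_neq0 z H) as H2.
set (a := ((1 + z ^ 2) / (1 - z ^ 2) ^ 2)%C).
match goal with |- 0 < Re ?u => replace u with (a - Cconj (z ^ 2 * a))%C end.
- replace (Re (a - Cconj (z ^ 2 * a))%C) with (Re (a - z ^ 2 * a)%C) by (cbn; ring).
  replace (a - z ^ 2 * a)%C with (cayley z) by (unfold a, cayley; field; exact H1).
  now apply cayley_pos.
- unfold a. rewrite Cmult_conj, Cdiv_conj by now apply Cpow_nz.
  rewrite !Cmult_conj, !Cpow_conj. field. auto.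
Qed.

Lemma LS_log_harmonic : log_harmonic (fun z => (z ^ 2)%C) LS.
Proof.
split; [exact analytic_square | split; [ | split; [exact LS_C1 | exact LS_log_harmonic_eq]]].
intros z H. rewrite Cmod_pow. pose proof (Cmod_ge_0 z). unfold unit_disk in H. nra.
Qed.

(** * Growth along a ray *)

(** For a unit complex number [c] with real part [k] and the square root [p] of
    [1 + s c] in the right half-plane, these are [|p|^2], [Re p] and
    [s exp (2 Re p) / |p + 1|^2] as functions of [s]. *)
Definition ray_mod (k s : R) : R := sqrt (1 + 2 * k * s + s ^ 2).
Definition ray_re (k s : R) : R := sqrt ((ray_mod k s + 1 + k * s) / 2).
Definition ray_gain (k s : R) : R :=
  s * exp (2 * ray_re k s) / (ray_mod k s + 2 * ray_re k s + 1).

Lemma ray_mod_sqr (k s : R) : -1 <= k <= 1 -> ray_mod k s ^ 2 = 1 + 2 * k * s + s ^ 2.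
Proof.
intros H. apply pow2_sqrt. assert (0 <= (1 + k) * (1 - k)) by nra.
pose proof (pow2_ge_0 (s + k)). nra.
Qed.

Lemma ray_mod_ge0 (k s : R) : 0 <= ray_mod k s.
Proof. apply sqrt_pos. Qed.

Lemma ray_mod_ge (k s : R) : -1 <= k <= 1 -> - (1 + k * s) <= ray_mod k s.
Proof.
intros H. pose proof (ray_mod_sqr k s H). pose proof (ray_mod_ge0 k s).
assert (0 <= (1 - k ^ 2) * s ^ 2) by (apply Rmult_le_pos; [nra | apply pow2_ge_0]).
apply Rnot_lt_le; intros F.
assert (ray_mod k s ^ 2 < (1 + k * s) ^ 2) by nra. nra.
Qed.

Lemma ray_re_sqr (k s : R) : -1 <= k <= 1 ->
  2 * ray_re k s ^ 2 = ray_mod k s + 1 + k * s.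
Proof.
intros H. pose proof (ray_mod_ge k s H).
unfold ray_re. rewrite pow2_sqrt; lra.
Qed.

(** The hypothesis on [k] and [s] says that [1 + s c] stays off the closed negative
    real axis, which these points only meet for [c = -1]. *)
Lemma ray_re_pos (k s : R) : -1 <= k <= 1 -> 0 < s -> -1 < k \/ s < 1 ->
  0 < ray_mod k s /\ 0 < ray_re k s.
Proof.
intros Hk Hs Hd.
pose proof (ray_mod_sqr k s Hk) as Em.
assert (Hr : 0 < 1 + 2 * k * s + s ^ 2).
{ assert (k = -1 \/ -1 < k) as [-> | H] by lra; [destruct Hd; nra | ].
  assert (0 < (k + 1) * s) by nra. pose proof (pow2_ge_0 (1 - s)). nra. }
assert (Hm : 0 < ray_mod k s) by now apply sqrt_lt_R0.
split; [exact Hm | ]. apply sqrt_lt_R0.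
assert (0 < ray_mod k s + 1 + k * s); [ | lra].
assert (k = -1 \/ -1 < k) as [-> | H] by lra; [destruct Hd; nra | ].
destruct (Req_dec k 1) as [-> | ?]; [nra | ].
assert (0 < (1 - k ^ 2) * s ^ 2) by (apply Rmult_lt_0_compat; [nra | now apply pow_lt]).
apply Rnot_le_lt; intros F. nra.
Qed.

(** In complex terms, [s dp/ds = (p^2 - 1) / (2 p)], so the logarithmic derivative
    [s d/ds] of [ray_gain] is [1 + Re ((p^2 - 1) / p - (p - 1) / p) = Re p]. *)
Lemma ray_gain_derive (k s : R) : -1 <= k <= 1 -> 0 < s -> -1 < k \/ s < 1 ->
  is_derive (ray_gain k) s (ray_gain k s * ray_re k s / s) /\
  0 < ray_gain k s * ray_re k s / s.
Proof.
intros Hk Hs Hd.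
pose proof (ray_mod_sqr k s Hk) as Em. pose proof (ray_re_sqr k s Hk) as Ea.
destruct (ray_re_pos k s Hk Hs Hd) as [Hm Ha].
assert (Hr : 0 < 1 + 2 * k * s + s ^ 2) by (rewrite <- Em; now apply pow_lt).
assert (Hb : 0 < ray_mod k s + 1 + k * s) by (rewrite <- Ea; pose proof (pow_lt _ 2 Ha); lra).
assert (Dm : is_derive (ray_mod k) s ((k + s) / ray_mod k s)).
{ unfold ray_mod. auto_derive.
  - cbn [pow] in Hr. lra.
  - replace (1 + 2 * k * s + s * (s * 1)) with (1 + 2 * k * s + s ^ 2) by ring.
    fold (ray_mod k s). field. lra. }
assert (Da : is_derive (ray_re k) s (((k + s) / ray_mod k s + k) / (4 * ray_re k s))).
{ unfold ray_re. auto_derive.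
  - repeat split; [eexists; exact Dm | lra].
  - replace (Derive (fun x => ray_mod k x) s) with ((k + s) / ray_mod k s)
      by (symmetry; now apply is_derive_unique).
    fold (ray_re k s).
    replace ((ray_mod k s + 1 + k * s) * / 2) with ((ray_mod k s + 1 + k * s) / 2) by reflexivity.
    fold (ray_re k s). field. lra. }
split.
- unfold ray_gain. auto_derive.
  + repeat split; [eexists; exact Da | eexists; exact Dm | eexists; exact Da | lra].
  + replace (Derive (fun x => ray_mod k x) s) with ((k + s) / ray_mod k s)
      by (symmetry; now apply is_derive_unique).
    replace (Derive (fun x => ray_re k x) s)
      with (((k + s) / ray_mod k s + k) / (4 * ray_re k s))
      by (symmetry; now apply is_derive_unique).
    set (E := exp _). set (m := ray_mod k s) in *. set (a := ray_re k s) in *.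
    (* The cofactors of the relations [Em] and [Ea] are found by eliminating [a ^ 2],
       then [m ^ 2]. *)
    field_simplify_eq; [ | lra].
    apply Rminus_diag_uniq.
    transitivity (2 * E * m * ((1 - m - 2 * a) * (2 * a ^ 2 - (m + 1 + k * s))
      - (m ^ 2 - (1 + 2 * k * s + s ^ 2)))); [ring | rewrite Em, Ea; ring].
- apply Rdiv_lt_0_compat; [ | exact Hs]. apply Rmult_lt_0_compat; [ | exact Ha].
  apply Rdiv_lt_0_compat; [ | lra]. apply Rmult_lt_0_compat; [exact Hs | apply exp_pos].
Qed.

Lemma ray_gain_continuous (k s : R) : continuous (ray_gain k) s.
Proof.
assert (Cm : continuous (ray_mod k) s).
{ apply continuous_sqrt_comp, (ex_derive_continuous (fun s => 1 + 2 * k * s + s ^ 2)).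
  auto_derive; trivial. }
assert (Ca : continuous (ray_re k) s).
{ apply continuous_sqrt_comp.
  apply (continuous_mult (K := R_AbsRing)); [ | apply continuous_const].
  apply (continuous_plus (V := R_NormedModule)).
  - apply (continuous_plus (V := R_NormedModule)); [exact Cm | apply continuous_const].
  - apply (ex_derive_continuous (fun s => k * s)). auto_derive; trivial. }
assert (Ca2 : continuous (fun s => 2 * ray_re k s) s).
{ apply (continuous_mult (K := R_AbsRing)); [apply continuous_const | exact Ca]. }
apply (continuous_mult (K := R_AbsRing)).
- apply (continuous_mult (K := R_AbsRing)); [apply continuous_id | ].
  now apply continuous_exp_comp.
- apply continuous_Rinv_comp.
  + apply (continuous_plus (V := R_NormedModule)); [ | apply continuous_const].
    now apply (continuous_plus (V := R_NormedModule)).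
  + pose proof (sqrt_pos (1 + 2 * k * s + s ^ 2)) as H1.
    pose proof (sqrt_pos ((ray_mod k s + 1 + k * s) / 2)) as H2.
    fold (ray_mod k s) in H1. fold (ray_re k s) in H2. lra.
Qed.

(** The mean value theorem only uses the derivative inside the interval, so [s2 = 1] is
    allowed for [k = -1], where the root [p] reaches [0]. *)
Lemma ray_gain_lt (k s1 s2 : R) : -1 <= k <= 1 -> 0 <= s1 < s2 ->
  -1 < k \/ s2 <= 1 -> ray_gain k s1 < ray_gain k s2.
Proof.
intros Hk [Hs1 Hs] Hd.
assert (D : forall s, s1 < s < s2 ->
  is_derive (ray_gain k) s (ray_gain k s * ray_re k s / s) /\
  0 < ray_gain k s * ray_re k s / s) by (intros s H; apply ray_gain_derive; lra).
assert (pr : forall s, s1 < s < s2 -> derivable_pt (ray_gain k) s).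
{ intros s H. eexists. apply is_derive_Reals, (proj1 (D s H)). }
destruct (MVT (ray_gain k) id s1 s2 pr (fun s _ => derivable_pt_id s)) as [c [Hc E]]; trivial.
- intros s _. apply continuity_pt_filterlim, ray_gain_continuous.
- intros s _. apply derivable_continuous_pt, derivable_pt_id.
- destruct (D c Hc) as [D1 D2].
  rewrite derive_pt_id, Derive_Reals, (is_derive_unique _ _ _ D1) in E.
  unfold id in E. nra.
Qed.

(** The gain at the end [p = 0] of the ray [c = -1]; it is the bound [1 / e] for the image
    on the imaginary axis. *)
Lemma ray_gain_slit : ray_gain (-1) 1 = 1.
Proof.
unfold ray_gain, ray_re, ray_mod.
replace (1 + 2 * -1 * 1 + 1 ^ 2) with 0 by ring. rewrite sqrt_0.
replace ((0 + 1 + -1 * 1) / 2) with 0 by field. rewrite sqrt_0, Rmult_0_r, exp_0. field.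
Qed.

(** Intermediate values between [s = 0] and a parameter where the gain exceeds [v]. For
    [k = -1] that parameter is [1]. For [k > -1] the gain is unbounded: its denominator
    grows linearly in [s], while [exp (2 Re p) >= 1 + 2 Re p] and
    [(Re p)^2 >= (s + 1) (1 + k) / 2]. *)
Lemma ray_gain_surj (k v : R) : -1 <= k <= 1 -> 0 < v -> -1 < k \/ v < 1 ->
  exists s, 0 < s /\ (-1 < k \/ s < 1) /\ ray_gain k s = v.
Proof.
intros Hk Hv Hd.
assert (H0 : ray_gain k 0 = 0) by (unfold ray_gain; lra).
assert (exists s, 0 < s /\ (-1 < k \/ s = 1) /\ v < ray_gain k s) as [b [Hb [Hb1 Hb2]]].
{ assert (k = -1 \/ -1 < k) as [-> | H] by lra.
  - exists 1. split; [lra | split; [now right | ]].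
    rewrite ray_gain_slit. lra.
  - clear Hd.
    (* The choice of [s] makes [Re p >= 3 v]. *)
    set (s := 1 + 18 * v ^ 2 / (1 + k)).
    assert (Hs : 1 <= s).
    { assert (0 <= 18 * v ^ 2 / (1 + k)) by (apply Rdiv_le_0_compat; nra). unfold s. lra. }
    exists s. split; [lra | split; [now left | ]].
    pose proof (ray_mod_sqr k s Hk) as Em. pose proof (ray_re_sqr k s Hk) as Ea.
    pose proof (sqrt_pos (1 + 2 * k * s + s ^ 2)) as Hm. fold (ray_mod k s) in Hm.
    pose proof (sqrt_pos ((ray_mod k s + 1 + k * s) / 2)) as Ha. fold (ray_re k s) in Ha.
    unfold ray_gain.
    set (m := ray_mod k s) in *. set (a := ray_re k s) in *.
    assert (M1 : s + k <= m) by (apply Rnot_lt_le; intros F; nra).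
    assert (M2 : m <= s + 1) by (apply Rnot_lt_le; intros F; nra).
    assert (A : 3 * v <= a).
    { assert ((s + 1) * (1 + k) / 2 <= a ^ 2) by nra.
      assert ((s - 1) * (1 + k) = 18 * v ^ 2) by (unfold s; field; lra).
      apply Rnot_lt_le; intros F. nra. }
    assert (B : m + 2 * a + 1 <= 6 * s).
    { assert (a ^ 2 <= s + 1) by nra. pose proof (pow2_ge_0 (a - 1)). nra. }
    pose proof (exp_ineq1_le (2 * a)) as X.
    apply (Rmult_lt_reg_r (m + 2 * a + 1)); [lra | ].
    unfold Rdiv. rewrite Rmult_assoc, Rinv_l, Rmult_1_r by lra.
    apply Rle_lt_trans with (v * (6 * s)); [apply Rmult_le_compat_l; lra | ].
    apply Rlt_le_trans with (s * (1 + 2 * a)); nra. }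
destruct (IVT_gen (ray_gain k) 0 b v) as [s [Hs E]].
- intros s. apply continuity_pt_filterlim, ray_gain_continuous.
- rewrite H0, Rmin_left, Rmax_right; lra.
- rewrite Rmin_left, Rmax_right in Hs by lra.
  assert (s <> 0) by (intros ->; lra). assert (s <> b) by (intros ->; lra).
  exists s. repeat split; trivial; lra.
Qed.

(** * Univalence and image *)

Definition koebe (z : C) : C := (z / (1 - z ^ 2))%C.

(** A square root in the right half-plane is determined by its square:
    [|p|^2 = |p^2|] and [2 (Re p)^2 = |p|^2 + Re (p^2)]. *)
Lemma ray_half_plane (p u : C) (s : R) : 0 < s -> Cmod u = 1 -> 0 < Re p ->
  (p ^ 2 = 1 + s * u ^ 2)%C ->
  let k := Re (u ^ 2)%C in
  (-1 < k \/ s < 1) /\ ray_mod k s = Cmod p ^ 2 /\ ray_re k s = Re p.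
Proof.
intros Hs Hu Hp E k.
assert (U : fst u ^ 2 + snd u ^ 2 = 1).
{ pose proof (Cmod2_alt u) as F. rewrite Hu in F. unfold Re, Im in F. lra. }
assert (Ek : k = fst u ^ 2 - snd u ^ 2) by (unfold k; cbn; ring).
clearbody k.
assert (E1 := f_equal fst E). assert (E2 := f_equal snd E). clear E.
destruct p as [a b], u as [x y]. change (0 < a) in Hp. cbn in E1, E2. cbn [fst snd] in U, Ek.
assert (P1 : a ^ 2 - b ^ 2 = 1 + s * k) by (rewrite Ek; lra).
assert (P2 : 2 * a * b = s * (2 * x * y)) by lra.
assert (K2 : 1 - k ^ 2 = (2 * x * y) ^ 2).
{ transitivity ((x ^ 2 + y ^ 2) ^ 2 - k ^ 2); [rewrite U | rewrite Ek]; ring. }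
assert (Em : ray_mod k s = a ^ 2 + b ^ 2).
{ unfold ray_mod. rewrite <- (sqrt_pow2 (a ^ 2 + b ^ 2)) by nra. f_equal.
  transitivity ((a ^ 2 - b ^ 2) ^ 2 + (2 * a * b) ^ 2); [ | ring].
  rewrite P1, P2, Rpow_mult_distr, <- K2. ring. }
repeat split.
- destruct (Rlt_le_dec (-1) k) as [H | H]; [now left | right].
  assert (k = -1) as -> by (pose proof (pow2_ge_0 x); lra).
  assert (2 * x * y = 0) as F by nra. rewrite F in P2.
  assert (b = 0) as -> by nra. nra.
- rewrite Cmod2_alt. exact Em.
- unfold ray_re. rewrite Em. transitivity (sqrt (a ^ 2)); [f_equal; lra | ].
  exact (sqrt_pow2 a (Rlt_le _ _ Hp)).
Qed.

Lemma koebe_cayley (z : C) : unit_disk z -> (cayley z ^ 2 = 1 + 4 * koebe z ^ 2)%C.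
Proof.
intros H. unfold cayley, koebe. field. now apply one_sub_sqr_neq0.
Qed.

(** With [p = cayley z] one has [1 - z^2 = 2 / (p + 1)] and
    [2 z^2 / (1 - z^2) = p - 1], hence
    [LS z = koebe z * 2 / |p + 1| * exp (Re p - 1)]. So [LS z] lies on the ray of
    [koebe z], and its modulus is governed by [ray_gain]. *)
Lemma LS_polar (z u : C) (t : R) : unit_disk z -> 0 < t -> Cmod u = 1 ->
  koebe z = (t * u)%C ->
  let k := Re (u ^ 2)%C in
  (-1 < k \/ 4 * t ^ 2 < 1) /\
  exists r : R, 0 < r /\ LS z = (r * u)%C /\ (r * exp 1) ^ 2 = ray_gain k (4 * t ^ 2).
Proof.
intros H Ht Hu Hz k.
pose proof (one_sub_sqr_neq0 z H) as H1.
pose proof (koebe_cayley z H) as Hp. pose proof (cayley_pos z H) as Hp0.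
destruct (ray_half_plane (cayley z) u (4 * t ^ 2)) as [D [Em Ea]]; trivial.
- nra.
- rewrite Hp, Hz. apply injective_projections; cbn; ring.
- split; [exact D | ].
  exists (t * Cmod (1 - z ^ 2)%C * exp (Re (cayley z) - 1)).
  assert (Hm : 0 < Cmod (1 - z ^ 2)%C) by now apply Cmod_gt_0.
  split; [ | split].
  + apply Rmult_lt_0_compat; [nra | apply exp_pos].
  + unfold LS. fold (koebe z). rewrite Hz.
    replace (Re (2 * z ^ 2 / (1 - z ^ 2))%C) with (Re (cayley z) - 1).
    * rewrite !RtoC_mult. ring.
    * replace (2 * z ^ 2 / (1 - z ^ 2))%C with (cayley z - 1)%C by (unfold cayley; field; auto).
      reflexivity.
  + fold k in Em, Ea. unfold ray_gain. rewrite Em, Ea.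
    assert (Hc : Cmod (1 - z ^ 2)%C ^ 2 * (Cmod (cayley z) ^ 2 + 2 * Re (cayley z) + 1) = 4).
    { replace (Cmod (cayley z) ^ 2 + 2 * Re (cayley z) + 1) with (Cmod (cayley z + 1)%C ^ 2)
        by (rewrite !Cmod2_alt; cbn; ring).
      rewrite <- Rpow_mult_distr, <- Cmod_mult.
      replace ((1 - z ^ 2) * (cayley z + 1))%C with (RtoC 2)
        by (unfold cayley; field; auto).
      rewrite Cmod_R, Rabs_pos_eq; lra. }
    replace (exp (2 * Re (cayley z))) with ((exp (Re (cayley z) - 1) * exp 1) ^ 2).
    * set (A := Cmod (1 - z ^ 2)%C) in *. pose proof (pow2_ge_0 (Cmod (cayley z))).
      rewrite <- Hc. field. lra.
    * rewrite <- exp_plus. cbn [pow]. rewrite Rmult_1_r, <- exp_plus. f_equal. ring.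
Qed.

(** Clearing denominators leaves [(z - w) (1 + z w) = 0], and [|z w| < 1]. *)
Lemma koebe_inj (z w : C) : unit_disk z -> unit_disk w -> koebe z = koebe w -> z = w.
Proof.
intros Hz Hw E.
pose proof (one_sub_sqr_neq0 z Hz) as H1. pose proof (one_sub_sqr_neq0 w Hw) as H2.
assert (F : ((z - w) * (1 + z * w) = 0)%C).
{ transitivity ((koebe z - koebe w) * ((1 - z ^ 2) * (1 - w ^ 2)))%C.
  - unfold koebe. field. auto.
  - rewrite E. ring. }
destruct (Ceq_dec (z - w)%C 0) as [G | G].
- transitivity (z - w + w)%C; [ring | rewrite G; ring].
- exfalso. apply (Cmult_neq_0 _ (1 + z * w)%C G); [intros F1 | exact F].
  assert (F2 : (z * w = - (1))%C) by (transitivity (1 + z * w - 1)%C; [ring | rewrite F1; ring]).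
  apply (f_equal Cmod) in F2. rewrite Cmod_mult, Cmod_m1 in F2.
  unfold unit_disk in *. pose proof (Cmod_ge_0 z). pose proof (Cmod_ge_0 w). nra.
Qed.

Lemma polar (w : C) : w <> 0 -> exists (t : R) (u : C), 0 < t /\ Cmod u = 1 /\ w = (t * u)%C.
Proof.
intros H. apply Cmod_gt_0 in H as Hm.
assert (Hc : RtoC (Cmod w) <> 0) by (intros E; apply RtoC_inj in E; lra).
exists (Cmod w), (w / Cmod w)%C. repeat split; trivial.
- rewrite Cmod_div, Cmod_R, Rabs_pos_eq by (trivial; lra). field. lra.
- field. exact Hc.
Qed.

Lemma polar_inj (r r' : R) (u u' : C) : 0 < r -> 0 < r' -> Cmod u = 1 -> Cmod u' = 1 ->
  (r * u = r' * u')%C -> r = r' /\ u = u'.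
Proof.
intros Hr Hr' Hu Hu' E.
assert (r = r') as <-.
{ apply (f_equal Cmod) in E. rewrite !Cmod_mult, !Cmod_R, !Rabs_pos_eq in E by lra. nra. }
split; trivial.
assert (Hc : RtoC r <> 0) by (intros F; apply RtoC_inj in F; lra).
transitivity (/ r * (r * u))%C; [field; exact Hc | rewrite E; field; exact Hc].
Qed.

Lemma unit_sqr_re (u : C) : Cmod u = 1 -> -1 <= Re (u ^ 2)%C <= 1.
Proof.
intros H. pose proof (Cmod2_alt u) as F. rewrite H in F. unfold Re, Im in F. cbn. nra.
Qed.

Lemma koebe_polar (z : C) : unit_disk z -> z <> 0 ->
  exists (t : R) (u : C), 0 < t /\ Cmod u = 1 /\ koebe z = (t * u)%C.
Proof.
intros H Hz. apply polar. intros E. apply Hz.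
pose proof (one_sub_sqr_neq0 z H) as H1.
transitivity (koebe z * (1 - z ^ 2))%C; [unfold koebe; field; exact H1 | rewrite E; ring].
Qed.

Lemma LS_0 : LS 0 = 0.
Proof. unfold LS, Cdiv. ring. Qed.

Lemma LS_neq0 (z : C) : unit_disk z -> z <> 0 -> LS z <> 0.
Proof.
intros H Hz. destruct (koebe_polar z H Hz) as [t [u [Ht [Hu E]]]].
destruct (LS_polar z u t H Ht Hu E) as [_ [r [Hr [-> _]]]].
apply Cmod_gt_0. rewrite Cmod_mult, Hu, Cmod_R, Rabs_pos_eq; lra.
Qed.

(** Equal values of [LS] put the two values of [koebe] on one ray, where the strict
    monotonicity of the gain makes them equal. *)
Lemma LS_univalent : univalent LS.
Proof.
intros z w Hz Hw E.
destruct (Ceq_dec z 0) as [-> | Nz], (Ceq_dec w 0) as [-> | Nw]; trivial.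
- rewrite LS_0 in E. now destruct (LS_neq0 w Hw Nw).
- rewrite LS_0 in E. now destruct (LS_neq0 z Hz Nz).
- destruct (koebe_polar z Hz Nz) as [t [u [Ht [Hu Kz]]]].
  destruct (koebe_polar w Hw Nw) as [t' [u' [Ht' [Hu' Kw]]]].
  destruct (LS_polar z u t Hz Ht Hu Kz) as [D [r [Hr [Lz G]]]].
  destruct (LS_polar w u' t' Hw Ht' Hu' Kw) as [D' [r' [Hr' [Lw G']]]].
  rewrite Lz, Lw in E. apply polar_inj in E as [<- <-]; trivial.
  rewrite G in G'. pose proof (unit_sqr_re u Hu) as Hk.
  apply koebe_inj; trivial. rewrite Kz, Kw. do 2 f_equal.
  destruct (Rtotal_order t t') as [L | [L | L]]; trivial; exfalso.
  + apply (Rlt_irrefl (ray_gain (Re (u ^ 2)%C) (4 * t ^ 2))).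
    rewrite G' at 2. apply ray_gain_lt; [exact Hk | split; nra | ].
    destruct D'; [now left | right; lra].
  + apply (Rlt_irrefl (ray_gain (Re (u ^ 2)%C) (4 * t ^ 2))).
    rewrite G' at 1. apply ray_gain_lt; [exact Hk | split; nra | ].
    destruct D; [now left | right; lra].
Qed.

(** Solving [z / (1 - z^2) = c] with [p = cayley z] gives [z = 2 c / (p + 1)]. It lies in
    the disk since [z^2 = (p - 1) / (p + 1)] with [p] nearer to [1] than to [-1]. *)
Lemma koebe_of_half_plane (p c : C) : 0 < Re p -> (p ^ 2 = 1 + 4 * c ^ 2)%C ->
  unit_disk (2 * c / (p + 1))%C /\ koebe (2 * c / (p + 1))%C = c.
Proof.
intros Hp E.
assert (Hp1 : (p + 1)%C <> 0).
{ intros F. apply (f_equal fst) in F. unfold Re in Hp. cbn in F. lra. }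
assert (Z2 : ((2 * c / (p + 1)) ^ 2 = (p - 1) / (p + 1))%C).
{ transitivity ((1 + 4 * c ^ 2 - 1) / (p + 1) ^ 2)%C; [field; exact Hp1 | ].
  rewrite <- E. field. exact Hp1. }
split.
- unfold unit_disk.
  assert (Cmod (2 * c / (p + 1))%C ^ 2 < 1).
  { rewrite <- Cmod_pow, Z2, Cmod_div by trivial.
    pose proof (proj1 (Cmod_gt_0 _) Hp1) as Q.
    apply (Rmult_lt_reg_r (Cmod (p + 1)%C)); [exact Q | ].
    unfold Rdiv. rewrite Rmult_assoc, Rinv_l, Rmult_1_l, Rmult_1_r by lra.
    apply sqrt_lt_1_alt. unfold Re in Hp. cbn.
    rewrite Ropp_0, !Rplus_0_r, !Rmult_1_r. split; [ | lra].
    apply Rplus_le_le_0_compat; apply Rle_0_sqr. }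
  pose proof (Cmod_ge_0 (2 * c / (p + 1))%C). nra.
- unfold koebe. rewrite Z2. field. split; [exact Hp1 | ].
  intros F. apply (f_equal fst) in F. cbn in F. lra.
Qed.

(** The real part is [ray_re], and the imaginary part follows from
    [2 Re p Im p = Im (p^2)]. *)
Lemma half_plane_root (u : C) (s : R) : 0 < s -> Cmod u = 1 ->
  -1 < Re (u ^ 2)%C \/ s < 1 ->
  exists p : C, 0 < Re p /\ (p ^ 2 = 1 + s * u ^ 2)%C.
Proof.
intros Hs Hu D. set (k := Re (u ^ 2)%C) in *.
pose proof (unit_sqr_re u Hu) as Hk. fold k in Hk.
destruct (ray_re_pos k s Hk Hs D) as [Hm Ha].
pose proof (ray_mod_sqr k s Hk) as Em. pose proof (ray_re_sqr k s Hk) as Ea.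
set (a := ray_re k s) in *. set (m := ray_mod k s) in *.
set (d := Im (u ^ 2)%C).
assert (Hd : k ^ 2 + d ^ 2 = 1).
{ unfold k, d. rewrite <- Cmod2_alt, Cmod_pow, Hu. ring. }
exists (a, s * d / (2 * a)). split; [exact Ha | ].
apply injective_projections.
- replace (fst (1 + s * u ^ 2)%C) with (1 + s * k) by (unfold k; cbn; ring).
  transitivity (((2 * a ^ 2) ^ 2 - s ^ 2 * d ^ 2) / (2 * (2 * a ^ 2))); [cbn; field; lra | ].
  rewrite Ea. replace (d ^ 2) with (1 - k ^ 2) by lra.
  replace ((m + 1 + k * s) ^ 2) with (m ^ 2 + 2 * m * (1 + k * s) + (1 + k * s) ^ 2) by ring.
  rewrite Em. field. rewrite <- Ea. nra.
- replace (snd (1 + s * u ^ 2)%C) with (s * d) by (unfold d; cbn; ring).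
  cbn. field. lra.
Qed.

(** On the ray through a unit [u] the values [r u] of [LS] are those for which
    [(r e)^2] is a value of [ray_gain (Re (u^2))]. These are all positive numbers unless
    [u^2 = -1], when they fill the open interval from [0]
    to [1]. *)
Lemma LS_range (w : C) :
  (exists z : C, unit_disk z /\ LS z = w) <-> ~ (Re w = 0 /\ Rabs (Im w) >= 1 / exp 1).
Proof.
pose proof (exp_pos 1) as He. split.
- intros [z [Hz <-]] [Hr Hi].
  assert (0 < 1 / exp 1) by (apply Rdiv_lt_0_compat; lra).
  destruct (Ceq_dec z 0) as [-> | Nz].
  { rewrite LS_0 in Hi. cbn in Hi. rewrite Rabs_R0 in Hi. lra. }
  destruct (koebe_polar z Hz Nz) as [t [u [Ht [Hu Kz]]]].
  destruct (LS_polar z u t Hz Ht Hu Kz) as [D [r [R0 [Lz G]]]].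
  rewrite Lz in Hr, Hi.
  assert (U : Re u ^ 2 + Im u ^ 2 = 1) by (rewrite <- Cmod2_alt, Hu; ring).
  rewrite re_scal_l in Hr. assert (Ur : Re u = 0) by nra.
  assert (K : Re (u ^ 2)%C = -1).
  { transitivity (Re u ^ 2 - Im u ^ 2); [unfold Re, Im; cbn; ring | nra]. }
  rewrite K in *.
  assert (L : ray_gain (-1) (4 * t ^ 2) < ray_gain (-1) 1).
  { apply ray_gain_lt; [lra | split; [nra | lra] | right; lra]. }
  rewrite <- G, ray_gain_slit in L.
  assert (L1 : r * exp 1 < 1) by nra.
  rewrite im_scal_l, Rabs_mult in Hi.
  replace (Rabs (Im u)) with 1 in Hi.
  + rewrite Rabs_pos_eq in Hi by lra.
    apply Rge_le, (Rmult_le_compat_r (exp 1)) in Hi; [ | lra].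
    unfold Rdiv in Hi. rewrite Rmult_assoc, Rinv_l in Hi by lra. lra.
  + rewrite <- (Rabs_pos_eq 1) by lra. apply Rsqr_eq_abs_0. unfold Rsqr. nra.
- intros N. destruct (Ceq_dec w 0) as [-> | Nw].
  { exists 0. split; [ | exact LS_0]. unfold unit_disk. rewrite Cmod_0. lra. }
  destruct (polar w Nw) as [r [u [Hr [Hu ->]]]].
  set (k := Re (u ^ 2)%C). pose proof (unit_sqr_re u Hu) as Hk. fold k in Hk.
  assert (U : Re u ^ 2 + Im u ^ 2 = 1) by (rewrite <- Cmod2_alt, Hu; ring).
  assert (Ek : k = Re u ^ 2 - Im u ^ 2) by (unfold k, Re, Im; cbn; ring).
  destruct (ray_gain_surj k ((r * exp 1) ^ 2)) as [s [Hs [D G]]]; trivial.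
  { apply pow_lt, Rmult_lt_0_compat; lra. }
  { destruct (Rlt_le_dec (-1) k) as [L | L]; [now left | right].
    assert (Ur : Re u = 0) by nra.
    assert (r * exp 1 < 1); [ | assert (0 < r * exp 1) by (apply Rmult_lt_0_compat; lra); nra].
    apply Rnot_le_lt; intros F. apply N.
    rewrite re_scal_l, im_scal_l, Ur, Rabs_mult, Rabs_pos_eq by lra.
    split; [ring | ].
    replace (Rabs (Im u)) with 1.
    - apply Rle_ge, (Rmult_le_reg_r (exp 1)); [lra | ].
      unfold Rdiv. rewrite Rmult_assoc, Rinv_l by lra. lra.
    - rewrite <- (Rabs_pos_eq 1) by lra. apply Rsqr_eq_abs_0. unfold Rsqr. nra. }
  destruct (half_plane_root u s Hs Hu D) as [p [Hp Ep]].
  set (t := sqrt s / 2). assert (Ht : 0 < t) by (apply Rdiv_lt_0_compat; [now apply sqrt_lt_R0 | lra]).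
  assert (Es : s = 4 * t ^ 2).
  { unfold t. transitivity (sqrt s ^ 2); [rewrite pow2_sqrt; lra | field]. }
  destruct (koebe_of_half_plane p (t * u)%C Hp) as [Hz Kz].
  { rewrite Ep, Es. apply injective_projections; cbn; ring. }
  eexists; split; [exact Hz | ].
  destruct (LS_polar _ u t Hz Ht Hu Kz) as [_ [r' [Hr' [-> G']]]].
  fold k in G'. rewrite <- Es, G in G'.
  assert (r' * exp 1 = r * exp 1) as F.
  { apply Rsqr_inj; [apply Rmult_le_pos; lra | apply Rmult_le_pos; lra | ].
    rewrite !Rsqr_pow2. exact G'. }
  apply Rmult_eq_reg_r in F; [now rewrite F | lra].
Qed.

Theorem mainTheorem5 :
  log_harmonic (fun z : C => (z ^ 2)%C) LS /\
  univalent LS /\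
  starlike LS /\
  (forall w : C,
     (exists z : C, unit_disk z /\ LS z = w) <->
     ~ (Re w = 0 /\ Rabs (Im w) >= 1 / exp 1)).
Proof.
split; [exact LS_log_harmonic | split; [exact LS_univalent | split; [ | exact LS_range]]].
exact (conj LS_univalent (conj LS_C1 (conj LS_0 LS_starlike_re))).
Qed.
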